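(* Let $(\mathcal A,\mu,\alpha)$ be a Hom-associative superalgebra and let $\mathcal R:\mathcal A\to\mathcal A$ be a strong anti-Rota–Baxter operator of weight zero on it. Then $(\mathcal A,\prec_{\mathcal R},\succ_{\mathcal R},\alpha)$ is a Hom-anti-dendriform superalgebra, where $\prec_{\mathcal R},\succ_{\mathcal R}:\mathcal A\times\mathcal A\to\mathcal A$ are defined by $$x\prec_{\mathcal R}y=-\mu(\mathcal R(x),y),\qquad x\succ_{\mathcal R}y=-\mu(x,\mathcal R(y)),\qquad x,y\in\mathcal A.$$
   Context: All vector spaces are finite-dimensional over a field of characteristic $0$ and $\mathbb Z_2$-graded; identities are required for homogeneous elements. A Hom-associative superalgebra is $(\mathcal A,\mu,\alpha)$ with $\mu:\mathcal A\times\mathcal A\to\mathcal A$ even bilinear, $\alpha:\mathcal A\to\mathcal A$ even linear and $\mu(\mu(x,y),\alpha(z))=\mu(\alpha(x),\mu(y,z))$. An anti-Rota–Baxter operator of weight zero on $(\mathcal A,\mu,\alpha)$ is an even linear map $\mathcal R:\mathcal A\to\mathcal A$ commuting with $\alpha$ such that $\mu(\mathcal R(x),\mathcal R(y))=-\mathcal R\big(\mu(\mathcal R(x),y)+\mu(x,\mathcal R(y))\big)$ for all $x,y$. It is strong if $\mu(\mu(\mathcal R(x),\mathcal R(y)),\alpha(z))=\mu(\alpha(x),\mu(\mathcal R(y),\mathcal R(z)))$ for all $x,y,z$. A Hom-anti-dendriform superalgebra is $(\mathcal A,\prec,\succ,\alpha)$ with $\prec,\succ$ even bilinear, $\alpha$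 even linear such that, with $x\cdot y=x\prec y+x\succ y$: $\alpha(x)\prec(y\prec z)=-(x\cdot y)\prec\alpha(z)=-\alpha(x)\succ(y\cdot z)=(x\succ y)\succ\alpha(z)$ and $(x\prec y)\succ\alpha(z)=\alpha(x)\prec(y\succ z)$. *)

(* Defs.v *)
From mathcomp Require Import all_boot all_order all_algebra.
From mathcomp Require Import sesquilinear.
Set Implicit Arguments.
Unset Strict Implicit.
Unset Printing Implicit Defensive.
Import GRing.Theory.
Local Open Scope ring_scope.

Record superspace (K : fieldType) := Superspace {
  carrier :> vectType K;
  part : 'Z_2 -> {vspace carrier};
  part_direct : directv (\sum_i part i);
  part_full : (\sum_i part i)%VS = fullv }.

Section Superalgebras.
Context {K : fieldType} {A : superspace K}.
Implicit Types (mu prec succ : A -> A -> A) (alpha R : A -> A).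

Definition homogeneous (x : A) : Prop := exists i, x \in part A i.

Definition even_linear (f : A -> A) : Prop :=
  linear f /\ forall i x, x \in part A i -> f x \in part A i.

Definition even_bilinear mu : Prop :=
  bilinear_for *:%R *:%R mu /\
  forall i j x y, x \in part A i -> y \in part A j ->
    mu x y \in part A (i + j).

Record hom_associative_superalgebra mu alpha : Prop := {
  hass_bilinear : even_bilinear mu;
  hass_linear : even_linear alpha;
  hass_assoc : forall x y z,
    homogeneous x -> homogeneous y -> homogeneous z ->
    mu (mu x y) (alpha z) = mu (alpha x) (mu y z) }.

(* Weight zero. *)
Record anti_Rota_Baxter mu alpha R : Prop := {
  arb_linear : even_linear R;
  arb_commute : forall x, R (alpha x) = alpha (R x);
  arb_eq : forall x y, homogeneous x -> homogeneous y ->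
    mu (R x) (R y) = - R (mu (R x) y + mu x (R y)) }.

Record strong_anti_Rota_Baxter mu alpha R : Prop := {
  sarb_anti_Rota_Baxter : anti_Rota_Baxter mu alpha R;
  sarb_strong : forall x y z,
    homogeneous x -> homogeneous y -> homogeneous z ->
    mu (mu (R x) (R y)) (alpha z) = mu (alpha x) (mu (R y) (R z)) }.

Record hom_anti_dendriform_superalgebra prec succ alpha : Prop := {
  had_prec_bilinear : even_bilinear prec;
  had_succ_bilinear : even_bilinear succ;
  had_linear : even_linear alpha;
  had_eq : forall x y z,
    homogeneous x -> homogeneous y -> homogeneous z ->
    let dot u v := prec u v + succ u v in
    [/\ prec (alpha x) (prec y z) = - prec (dot x y) (alpha z),
        - prec (dot x y) (alpha z) = - succ (alpha x) (dot y z),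
        - succ (alpha x) (dot y z) = succ (succ x y) (alpha z)
      & succ (prec x y) (alpha z) = prec (alpha x) (succ y z)] }.

Definition prec_of mu R : A -> A -> A := fun x y => - mu (R x) y.
Definition succ_of mu R : A -> A -> A := fun x y => - mu x (R y).

End Superalgebras.

(* Main.v *)
Require Import Defs.
From mathcomp Require Import all_boot all_order all_algebra.
Import GRing.Theory.
Local Open Scope ring_scope.

(** The anti-Rota-Baxter identity says exactly that [R] turns the total product
    [dot x y = prec x y + succ x y] into the original one:
    [R (dot x y) = mu (R x) (R y)] ([anti_Rota_Baxter_dot]).  Writing [R alpha = alpha R], the four members of
    the chain of axioms become

      [mu (alpha (R x)) (mu (R y) z)],  [mu (mu (R x) (R y)) (alpha z)],
      [mu (alpha x) (mu (R y) (R z))],  [mu (mu x (R y)) (alpha (R z))].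

    The first two agree by Hom-associativity on [(R x, R y, z)], the last two by
    Hom-associativity on [(x, R y, R z)], and strongness is the missing link
    between the two pairs.  The remaining axiom is Hom-associativity on
    [(R x, y, R z)]. *)

Section InducedProducts.
Context {K : fieldType} {A : superspace K}.
Implicit Types (mu : A -> A -> A) (alpha R f : A -> A).

Lemma even_linear_homogeneous f (x : A) :
  even_linear f -> homogeneous x -> homogeneous (f x).
Proof. by move=> [_ f_even] [i xi]; exists i; apply: f_even. Qed.

Lemma linear_opp {U V : lmodType K} {g : U -> V} :
  linear g -> forall x, g (- x) = - g x.
Proof.
by move=> g_lin x; rewrite -scaleN1r (scalable_linear g_lin) /= scaleN1r.
Qed.

Lemma even_bilinear_prec mu R :
  even_bilinear mu -> even_linear R -> even_bilinear (prec_of mu R).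
Proof.
move=> [[mul mur] mu_even] [R_lin R_even]; split; last first.
  by move=> i j x y xi yj; rewrite rpredN; apply: mu_even => //; apply: R_even.
split=> u a x y; rewrite /prec_of /=.
  by rewrite R_lin (mul u) opprD scalerN.
by rewrite (mur (R u)) opprD scalerN.
Qed.

Lemma even_bilinear_succ mu R :
  even_bilinear mu -> even_linear R -> even_bilinear (succ_of mu R).
Proof.
move=> [[mul mur] mu_even] [R_lin R_even]; split; last first.
  by move=> i j x y xi yj; rewrite rpredN; apply: mu_even => //; apply: R_even.
split=> u a x y; rewrite /succ_of /=.
  by rewrite (mul (R u)) opprD scalerN.
by rewrite R_lin (mur u) opprD scalerN.
Qed.

(** The minus signs in the two induced products absorb the one in the
    anti-Rota-Baxter identity, so that [R] is multiplicative. *)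
Lemma anti_Rota_Baxter_dot mu alpha R x y :
    anti_Rota_Baxter mu alpha R -> homogeneous x -> homogeneous y ->
  R (prec_of mu R x y + succ_of mu R x y) = mu (R x) (R y).
Proof.
move=> R_arb hx hy; have [R_lin _] := arb_linear R_arb.
by rewrite /prec_of /succ_of -opprD (linear_opp R_lin) (arb_eq R_arb).
Qed.

End InducedProducts.

Theorem corollary3p1 (K : fieldType) (K_char0 : [pchar K] =i pred0)
    (A : superspace K) (mu : A -> A -> A) (alpha R : A -> A)
    (mu_hass : hom_associative_superalgebra mu alpha)
    (R_sarb : strong_anti_Rota_Baxter mu alpha R) :
  hom_anti_dendriform_superalgebra (prec_of mu R) (succ_of mu R) alpha.
Proof.
have R_arb := sarb_anti_Rota_Baxter R_sarb.
have mu_bil := hass_bilinear mu_hass; have R_even := arb_linear R_arb.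
split; [exact: even_bilinear_prec | exact: even_bilinear_succ
       | exact: hass_linear mu_hass |].
move=> x y z hx hy hz dot.
have [[mul mur] _] := mu_bil.
have muNl u v : mu (- u) v = - mu u v by exact: (linear_opp (mul v)).
have muNr u v : mu u (- v) = - mu u v by exact: (linear_opp (mur u)).
have hR u : homogeneous u -> homogeneous (R u).
  exact: even_linear_homogeneous R_even.
have R_dot u v : homogeneous u -> homogeneous v -> R (dot u v) = mu (R u) (R v).
  exact: anti_Rota_Baxter_dot R_arb.
have assoc := hass_assoc mu_hass.
rewrite /prec_of /succ_of !R_dot // !(arb_commute R_arb) !muNl !muNr !opprK.
split.
- by rewrite assoc //; exact: hR.
- exact: sarb_strong R_sarb _ _ _ hx hy hz.
- by rewrite assoc //; exact: hR.
- by rewrite assoc //; exact: hR.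
Qed.
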